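(* Let $X$ be a stationary Cox point process on $\mathbb{R}^2$ with (random) intensity measure $\Lambda$ satisfying $$\limsup_{n\uparrow\infty}|B_n|^{-1}\log\mathbb{E}\big[\exp\big(-\Lambda(B_n)\big)\big]<0$$ and $$\limsup_{n\uparrow\infty}|B_{n+4}\setminus B_n|^{-1}\log\mathbb{E}\big[\exp\big(\beta(\Lambda(B_{n+4})-\Lambda(B_n))\big)\big]<\infty\qquad\text{for all }\beta>0.$$ Then the Voronoi tessellation $S=S_{\rm V}(X)$ satisfies $\mathbb{E}[\exp(\alpha|S\cap B_1|)]<\infty$ for all $\alpha\in\mathbb{R}$.
   Context: $B_r\subset\mathbb{R}^2$ is the closed disk of radius $r>0$ centered at the origin; $|B_n|$ and $|B_{n+4}\setminus B_n|$ denote Lebesgue measure. For a tessellation $S$ and measurable $A\subset\mathbb{R}^2$, $|S\cap A|=\nu_1(S\cap A)$ is the total edge length in $A$, $\nu_1$ being one-dimensional Hausdorff measure. A Cox point process with random intensity measure $\Lambda$ is a point process which, conditionally on $\Lambda$, is a Poisson point process with intensity measure $\Lambda$. Point processes $X=\{X_i\}_{i\in I}$ are stationary with intensity $0<\lambda<\infty$. The Voronoi tessellation is $S_{\rm V}(X)=\bigcup_{i\in I}\partial\{x\in\mathbb{R}^2: |x-X_i|=\inf_{j\in I}|x-X_j|\}$, where $\partial$ denotes the boundary. *)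

(* Defs.v *)
From HB Require Import structures.
From mathcomp Require Import all_boot all_order all_algebra.
From mathcomp Require Import all_classical all_reals all_analysis.
From mathcomp Require Import measurable_realfun.

Set Implicit Arguments.
Unset Strict Implicit.
Unset Printing Implicit Defensive.

Import Order.TTheory GRing.Theory Num.Theory.
Import numFieldNormedType.Exports.

Local Open Scope classical_set_scope.
Local Open Scope ring_scope.

Definition plane (R : realType) := (measurableTypeR R * measurableTypeR R)%type.

(* The library norm on a product is the maximum norm, hence this definition. *)
Definition euclid_dist {R : realType} (x y : plane R) : R :=
  Num.sqrt ((x.1 - y.1 : R) ^+ 2 + (x.2 - y.2 : R) ^+ 2).

Definition disk {R : realType} (r : R) : set (plane R) :=
  [set x | euclid_dist x (0 : R, 0 : R) <= r].

Definition area {R : realType} : set (plane R) -> \bar R :=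
  (@lebesgue_measure R \x @lebesgue_measure R)%E.

Definition boundary {R : realType} (A : set (plane R)) : set (plane R) :=
  closure (A : set (R * R)) `\` interior (A : set (R * R)).

(* The supremum is floored at 0 so that the empty set has diameter 0, not -oo. *)
Definition ediam {R : realType} (U : set (plane R)) : \bar R :=
  maxe 0%E (ereal_sup [set (euclid_dist p.1 p.2)%:E | p in U `*` U]).

Definition hausdorff1_delta {R : realType} (delta : R) (A : set (plane R)) :
    \bar R :=
  ereal_inf [set (\sum_(0 <= i <oo) ediam (U i))%E |
    U in [set U : nat -> set (plane R) |
      A `<=` \bigcup_i U i /\ forall i, (ediam (U i) <= delta%:E)%E]].

Definition hausdorff1 {R : realType} (A : set (plane R)) : \bar R :=
  ereal_sup [set hausdorff1_delta delta A | delta in [set delta : R | 0 < delta]].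

Definition voronoi_cell {R : realType} (I : set nat) (x : nat -> plane R)
    (i : nat) : set (plane R) :=
  [set y | euclid_dist y (x i) = inf [set euclid_dist y (x j) | j in I]].

Definition voronoi {R : realType} (I : set nat) (x : nat -> plane R) :
    set (plane R) :=
  \bigcup_(i in I) boundary (voronoi_cell I x i).

(* A point process is given by its (random) index set [I w] and its points
   [x w i], [i \in I w]; points may be repeated, and [I w] may be finite.
   Measurability is only required of the counting variables, so the choice of
   the enumeration is immaterial. *)
Definition counting_of {R : realType} (I : set nat) (x : nat -> plane R)
    (A : set (plane R)) : \bar R :=
  (\esum_(i in I) \d_(x i) A)%E.

Definition locally_finite {R : realType} (m : set (plane R) -> \bar R) : Prop :=
  forall r : R, (m (disk r) < +oo)%E.

Definition is_point_process d (Omega : measurableType d) (R : realType)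
    (I : Omega -> set nat) (x : Omega -> nat -> plane R) : Prop :=
  (forall A : set (plane R), measurable A ->
     measurable_fun setT (fun w => counting_of (I w) (x w) A)) /\
  (forall w, locally_finite (counting_of (I w) (x w))).

(* The sigma-algebra on measures (seen as set functions) generated by the
   evaluations [m |-> m A], [A] Borel. *)
Definition evaluation_sigma {R : realType} :
    set_system (set (plane R) -> \bar R) :=
  <<s \bigcup_(A in [set A : set (plane R) | measurable A])
        preimage_set_system setT
          (fun m : set (plane R) -> \bar R => m A) measurable >>.

Definition stationary d (Omega : measurableType d) (R : realType)
    (P : probability Omega R)
    (I : Omega -> set nat) (x : Omega -> nat -> plane R) : Prop :=
  forall (t : plane R) (E : set (set (plane R) -> \bar R)),
    evaluation_sigma E ->
    P [set w | E (counting_of (I w)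
                    (fun i => ((x w i).1 + t.1 : R, (x w i).2 + t.2 : R)))] =
    P [set w | E (counting_of (I w) (x w))].

Definition unit_square {R : realType} : set (plane R) :=
  [set` `[0 : R, 1]] `*` [set` `[0 : R, 1]].

Definition has_intensity d (Omega : measurableType d) (R : realType)
    (P : probability Omega R)
    (I : Omega -> set nat) (x : Omega -> nat -> plane R) (lambda : R) : Prop :=
  (\int[P]_w counting_of (I w) (x w) unit_square)%E = lambda%:E :> \bar R.

Definition generated_sigma d (Omega : measurableType d) (R : realType)
    (Lambda : Omega -> set (plane R) -> \bar R) : set_system Omega :=
  preimage_set_system setT Lambda (evaluation_sigma).

Definition is_conditional_probability d (Omega : measurableType d)
    (R : realType) (P : probability Omega R) (F : set_system Omega)
    (E : set Omega) (Y : Omega -> \bar R) : Prop :=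
  (forall B : set (\bar R), measurable B -> F (Y @^-1` B)) /\
  (forall G, F G -> P (E `&` G) = \int[P]_(w in G) Y w)%E.

(* Not the library's [poisson_pmf], which is 1 for every [n] at rate 0. *)
Definition poisson_mass {R : realType} (r : R) (n : nat) : R :=
  expR (- r) * r ^+ n / n`!%:R.

(* Conditionally on [Lambda], the numbers of points in disjoint bounded Borel
   sets [A i] are independent and Poisson with parameters [Lambda (A i)]. *)
Definition is_cox d (Omega : measurableType d) (R : realType)
    (P : probability Omega R) (Lambda : R.-ker Omega ~> plane R)
    (I : Omega -> set nat) (x : Omega -> nat -> plane R) : Prop :=
  forall (k : nat) (A : 'I_k -> set (plane R)) (n : 'I_k -> nat),
    (forall i, measurable (A i)) ->
    (forall i, exists r : R, A i `<=` disk r) ->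
    trivIset setT A ->
    is_conditional_probability P
      (generated_sigma (fun w => Lambda w : set (plane R) -> \bar R))
      [set w | forall i, counting_of (I w) (x w) (A i) = (n i)%:R%:E]
      (fun w => (\prod_(i < k) poisson_mass (fine (Lambda w (A i))) (n i))%:E).

(* Main.v *)
Require Import Defs.
From HB Require Import structures.
From mathcomp Require Import all_boot all_order all_algebra.
From mathcomp Require Import all_classical all_reals all_analysis.
From mathcomp Require Import measurable_realfun finmap.
From mathcomp Require Import ring lra.

(** A Voronoi cell is convex, so its boundary has bounded length inside the unit
    disk, whatever the points are ([supported_cover]). Hence the length of the
    tessellation in [disk 1] is at most a constant times the number of points
    whose cell has a boundary meeting [disk 1] ([voronoi_length]). If [m] is the
    largest integer such that [disk m] is free of points, then all these points
    lie in [annulus m], the points of [disk (m + 4)] outside [disk m]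
    ([voronoi_length_cases]).

    So one has to sum over [m] the expectation of an exponential of the number
    of points in [annulus m], on the event that [disk m] is empty. For a Cox
    process, the probability of this event is the Laplace transform of the
    intensity ([cox_void]), which the first condition makes smaller than
    [expR (- c * m ^ 2)]. Exponential moments of the number of points in the
    annulus are exponential moments of its intensity ([cox_exp_moment]), which
    the second condition bounds by the exponential of a multiple of the area of
    the annulus ([annulus_exp_rate]). This area is of smaller order than [m ^ 2]
    ([area_annulus_le]), so the void probability wins, and the terms are
    summable ([voronoi_exp_moment]).

    Both conditions are asymptotic, so that the case where [m] is small, or
    where [disk 0] contains a point, needs exponential moments of the number of
    points in one fixed disk. They follow from stationarity: the disk is covered
    by finitely many unit squares, each of which can be translated into an
    annulus of large radius ([exp_moments_unit_square], [exp_moments_disk]). *)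

Set Implicit Arguments.
Unset Strict Implicit.
Unset Printing Implicit Defensive.

Import Order.TTheory GRing.Theory Num.Theory.
Import numFieldNormedType.Exports.

Local Open Scope classical_set_scope.
Local Open Scope ring_scope.

(** * Euclidean distance and Voronoi cells *)

Lemma euclid_dist_ge0 (R : realType) (x y : plane R) : 0 <= euclid_dist x y.
Proof. exact: sqrtr_ge0. Qed.

Lemma euclid_dist_sqr (R : realType) (x y : plane R) :
  euclid_dist x y ^+ 2 = (x.1 - y.1) ^+ 2 + (x.2 - y.2) ^+ 2.
Proof. by rewrite sqr_sqrtr// addr_ge0 ?sqr_ge0. Qed.

Lemma euclid_distC (R : realType) (x y : plane R) :
  euclid_dist x y = euclid_dist y x.
Proof. by congr (Num.sqrt (_ + _)); rewrite -sqrrN opprB. Qed.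

Lemma euclid_dist_triangle (R : realType) (x y z : plane R) :
  euclid_dist x z <= euclid_dist x y + euclid_dist y z.
Proof.
rewrite -(@ler_pXn2r _ 2)// ?nnegrE ?addr_ge0 ?euclid_dist_ge0//.
rewrite sqrrD !euclid_dist_sqr.
set a := x.1 - y.1; set b := x.2 - y.2; set c := y.1 - z.1; set e := y.2 - z.2.
have -> : x.1 - z.1 = a + c by rewrite /a /c; ring.
have -> : x.2 - z.2 = b + e by rewrite /b /e; ring.
suff : a * c + b * e <= euclid_dist x y * euclid_dist y z by nra.
rewrite (le_trans (ler_norm _))// -(@ler_pXn2r _ 2)// ?nnegrE ?mulr_ge0 ?euclid_dist_ge0//.
rewrite exprMn !euclid_dist_sqr -/a -/b -/c -/e real_normK ?num_real//.
have := sqr_ge0 (a * e - b * c); nra.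
Qed.

Lemma euclid_dist_le_l1 (R : realType) (x y : plane R) :
  euclid_dist x y <= `|x.1 - y.1| + `|x.2 - y.2|.
Proof.
rewrite -(@ler_pXn2r _ 2)// ?nnegrE ?addr_ge0 ?euclid_dist_ge0//.
rewrite sqrrD euclid_dist_sqr !real_normK ?num_real//.
have : 0 <= `|x.1 - y.1| * `|x.2 - y.2| by rewrite mulr_ge0.
nra.
Qed.

Lemma le_euclid_dist1 (R : realType) (x y : plane R) :
  `|x.1 - y.1| <= euclid_dist x y.
Proof.
rewrite -(@ler_pXn2r _ 2)// ?nnegrE ?euclid_dist_ge0//.
by rewrite euclid_dist_sqr real_normK ?num_real// lerDl sqr_ge0.
Qed.

Lemma le_euclid_dist2 (R : realType) (x y : plane R) :
  `|x.2 - y.2| <= euclid_dist x y.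
Proof.
rewrite -(@ler_pXn2r _ 2)// ?nnegrE ?euclid_dist_ge0//.
by rewrite euclid_dist_sqr real_normK ?num_real// lerDr sqr_ge0.
Qed.

(** The topology of the plane comes from the maximum norm; this comparison is
    what lets closures and interiors be tested with Euclidean distances. *)
Lemma euclid_dist_ball (R : realType) (y z : plane R) (e : R) :
  ball (y : R * R) e (z : R * R) -> euclid_dist y z <= 2 * e.
Proof.
move=> [/= b1 b2]; rewrite (le_trans (euclid_dist_le_l1 _ _))//.
by rewrite mulr2n mulrDl !mul1r lerD// ltW.
Qed.

Lemma closure_euclid (R : realType) (A : set (plane R)) (y : plane R) (e : R) :
  closure (A : set (R * R)) y -> 0 < e ->
  exists2 z : plane R, A z & euclid_dist y z <= e.
Proof.
move=> Ay e0; have e20 : 0 < e / 2 by rewrite divr_gt0.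
have [z [Az yz]] := Ay _ (nbhsx_ballx (y : R * R) _ e20).
exists z => //; have := euclid_dist_ball yz.
by rewrite mulrC divfK.
Qed.

Lemma interior_euclid (R : realType) (A : set (plane R)) (y : plane R) (e : R) :
  0 < e -> (forall z : plane R, euclid_dist y z <= e -> A z) ->
  interior (A : set (R * R)) y.
Proof.
move=> e0 Ae; apply/nbhs_ballP; exists (e / 2) => /=; first by rewrite divr_gt0.
move=> z yz; apply: Ae; have := euclid_dist_ball yz.
by rewrite mulrC divfK.
Qed.

Lemma voronoi_cellP (R : realType) (I : set nat) (x : nat -> plane R) (i : nat)
    (y : plane R) : I i ->
  voronoi_cell I x i y <->
  forall j, I j -> euclid_dist y (x i) <= euclid_dist y (x j).
Proof.
move=> Ii; set D := [set euclid_dist y (x j) | j in I].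
have hD : has_inf D.
  split; first by exists (euclid_dist y (x i)), i.
  by exists 0 => _ [j _ <-]; exact: euclid_dist_ge0.
split=> [/= -> j Ij|le_i]; first by apply: ge_inf; [exact: hD.2|exists j].
apply/eqP; rewrite eq_le; apply/andP; split.
  by apply: lb_le_inf; [exact: hD.1|move=> _ [j Ij <-]; exact: le_i].
by apply: ge_inf; [exact: hD.2|exists i].
Qed.

(** * Counting points, and covering boundaries of convex sets *)

Lemma counting_ofE (R : realType) (I : set nat) (x : nat -> plane R)
    (A : set (plane R)) :
  counting_of I x A = (\esum_(i in I `&` x @^-1` A) 1)%E.
Proof.
rewrite esum_mkcondr; apply: eq_esum => i Ii.
have -> : (i \in x @^-1` A) = (x i \in A) by apply/idP/idP => /set_mem ?; exact/mem_set.
by rewrite diracE; case: (x i \in A).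
Qed.

(** A counting variable that is finite is the cardinal of a finite set of
    indices: an infinite set of indices would contribute infinite mass. *)
Lemma counting_of_card (R : realType) (I : set nat) (x : nat -> plane R)
    (A : set (plane R)) : (counting_of I x A < +oo)%E ->
  finite_set (I `&` x @^-1` A) /\
  counting_of I x A = (#|` fset_set (I `&` x @^-1` A)|%:R)%:E.
Proof.
rewrite counting_ofE => cfin; suff finD : finite_set (I `&` x @^-1` A).
  by split => //; exact: finite_card_sum.
apply: contrapT => infD; move: cfin.
suff -> : (\esum_(i in I `&` x @^-1` A) 1)%E = +oo%E :> \bar R by [].
rewrite -(infinite_card_dirac R infD); apply: eq_esum => i Di.
by rewrite diracE mem_set.
Qed.

Lemma counting_of_subset (R : realType) (I : set nat) (x : nat -> plane R)
    (A B : set (plane R)) : A `<=` B ->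
  (counting_of I x A <= counting_of I x B)%E.
Proof.
move=> AB; apply: le_esum => i _; rewrite !diracE lee_fin ler_nat.
by have [/set_mem/AB/mem_set ->|] := boolP (x i \in A).
Qed.

Lemma counting_ofU (R : realType) (I : set nat) (x : nat -> plane R)
    (A B : set (plane R)) :
  (counting_of I x (A `|` B) <= counting_of I x A + counting_of I x B)%E.
Proof.
rewrite -esumD//; apply: le_esum => i _; rewrite !diracE in_setU -EFinD.
by rewrite lee_fin -natrD ler_nat; case: (_ \in A); case: (_ \in B).
Qed.

(** The property of (a part of) the boundary of a convex set that the length
    estimate uses: a supporting line passes through every point. It is
    stated without mention of the convex set, so that it passes to subsets. *)
Definition supported (R : realType) (B : set (plane R)) : Prop :=
  forall y, B y -> exists2 u : R * R, u <> 0 &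
    forall z, B z -> u.1 * (z.1 - y.1) + u.2 * (z.2 - y.2) <= 0.

Lemma ediam_le (R : realType) (U : set (plane R)) (e : R) : 0 <= e ->
  (forall y z, U y -> U z -> euclid_dist y z <= e) -> (ediam U <= e%:E)%E.
Proof.
move=> e0 Ue; rewrite /ediam ge_max lee_fin e0 /=.
by apply: ge_ereal_sup => _ [[y z] /= [Uy Uz] <-]; rewrite lee_fin Ue.
Qed.

Lemma ediam_ge0 (R : realType) (U : set (plane R)) : (0 <= ediam U)%E.
Proof. by rewrite /ediam le_max lexx. Qed.

(** The vectors [(u, v)] and [(u', v')] are outer normals, in one closed
    quadrant, at the two ends of the displacement [(a, b)]. They force [a] and
    [b] to have opposite signs, and then the l1-norm of the displacement is
    [`|a - b|]. *)
Lemma antimonotone_dist (R : realType) (a b u v u' v' : R) :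
  (u != 0) || (v != 0) -> (u' != 0) || (v' != 0) ->
  0 <= u -> 0 <= v -> 0 <= u' -> 0 <= v' ->
  u * a + v * b <= 0 -> 0 <= u' * a + v' * b ->
  `|a| + `|b| <= `|a - b|.
Proof.
move=> uv uv' u0 v0 u'0 v'0 h h'.
have [a0|a0] := leP 0 a; have [b0|b0] := leP 0 b.
- have [|/eqP ane] := eqVneq a 0; first by move=> ->; rewrite normr0 add0r sub0r normrN.
  have [|/eqP bne] := eqVneq b 0; first by move=> ->; rewrite normr0 addr0 subr0.
  exfalso; have {}a0 : 0 < a by rewrite lt_neqAle a0 andbT eq_sym; apply/eqP.
  have {}b0 : 0 < b by rewrite lt_neqAle b0 andbT eq_sym; apply/eqP.
  case/orP: uv => [un|vn].
    have : 0 < u * a by rewrite mulr_gt0// lt_neqAle eq_sym un.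
    have : 0 <= v * b by rewrite mulr_ge0// ltW.
    lra.
  have : 0 < v * b by rewrite mulr_gt0// lt_neqAle eq_sym vn.
  have : 0 <= u * a by rewrite mulr_ge0// ltW.
  lra.
- by rewrite ger0_norm// ltr0_norm// ger0_norm ?subr_ge0 ?(le_trans (ltW b0)).
- rewrite ltr0_norm// ger0_norm// ltr0_norm ?subr_lt0 ?(lt_le_trans a0)//.
  by rewrite opprB addrC.
- exfalso; case/orP: uv' => [un|vn].
    have : u' * a < 0 by rewrite pmulr_rlt0// lt_neqAle eq_sym un.
    have : v' * b <= 0 by rewrite mulr_ge0_le0// ltW.
    lra.
  have : v' * b < 0 by rewrite pmulr_rlt0// lt_neqAle eq_sym vn.
  have : u' * a <= 0 by rewrite mulr_ge0_le0// ltW.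
  lra.
Qed.

Lemma truncn_eq_dist (R : realType) (a b : R) : 0 <= a -> 0 <= b ->
  Num.truncn a = Num.truncn b -> `|a - b| <= 1.
Proof.
move=> a0 b0 ab; have := truncn_itv a0; have := truncn_itv b0.
rewrite ab -natr1 ler_norml; lra.
Qed.

(** Sort the points of [B] by the quadrant of an outer normal. Within one class
    and after reflecting the axes, two points are never ordered strictly in
    both coordinates, so the difference [t] of the coordinates determines the
    point, and the Euclidean distance is at most the difference of the values
    of [t] (see [antimonotone_dist]). Since [t] ranges over [[-2, 2]], cutting
    this interval into pieces of length [4 / m.+1] cuts [B] into pieces of at
    most that diameter. *)
Lemma supported_cover (R : realType) (B : set (plane R)) (m : nat) :
  supported B -> B `<=` disk 1 ->
  exists V : bool * bool * 'I_m.+2 -> set (plane R),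
    B `<=` \bigcup_t V t /\ forall t, (ediam (V t) <= (4 / m.+1%:R)%:E)%E.
Proof.
move=> sB B1.
pose sg (b : bool) : R := if b then 1 else -1.
have sgM b (c c' : R) : (sg b * c) * (sg b * c') = c * c'.
  by rewrite /sg; case: b; rewrite ?mul1r// mulrACA mulN1r opprK mul1r.
have sg0 b (c : R) : (sg b * c != 0) = (c != 0).
  by rewrite /sg; case: b; rewrite ?mul1r// mulN1r oppr_eq0.
have sgn b (c : R) : `|sg b * c| = `|c|.
  by rewrite /sg; case: b; rewrite ?mul1r// mulN1r normrN.
pose T b1 b2 (y : plane R) := sg b1 * y.1 - sg b2 * y.2.
pose M : R := m.+1%:R; have M0 : 0 < M by rewrite ltr0n.
have T2 b1 b2 y : disk 1 y -> - 2 <= T b1 b2 y <= 2.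
  rewrite {1}/disk /= => y1; rewrite -ler_norml /T (le_trans (ler_normB _ _))//.
  rewrite !sgn; have := le_euclid_dist1 y (0, 0).
  have := le_euclid_dist2 y (0, 0); rewrite !subr0; lra.
(* The value [t = 2] falls into a cell of its own, hence [m.+2] cells. *)
pose V (t : bool * bool * 'I_m.+2) : set (plane R) := [set y |
  [/\ B y, Num.truncn ((T t.1.1 t.1.2 y + 2) * (M / 4)) = t.2 :> nat &
  exists u : R * R, [/\ (u.1 != 0) || (u.2 != 0), 0 <= sg t.1.1 * u.1,
    0 <= sg t.1.2 * u.2 & forall z, B z ->
    u.1 * (z.1 - y.1) + u.2 * (z.2 - y.2) <= 0]]].
exists V; split=> [y By|[[b1 b2] k]].
  have [u u0 uB] := sB _ By.
  have ltm : (Num.truncn ((T (0 <= u.1)%R (0 <= u.2)%R y + 2) * (M / 4))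
      < m.+2)%N.
    have := T2 (0 <= u.1) (0 <= u.2) y (B1 _ By); set t := T _ _ _ => t2.
    rewrite truncn_lt_nat; last by rewrite mulr_ge0 ?divr_ge0 ?(ltW M0)//; lra.
    apply: (@le_lt_trans _ _ M); last by rewrite ltr_nat.
    rewrite mulrCA ler_piMr ?(ltW M0)//; lra.
  exists (0 <= u.1, 0 <= u.2, Ordinal ltm) => //; split => //=; exists u.
  split => //.
  - rewrite -negb_and; apply/negP => /andP[/eqP u1 /eqP u2]; apply: u0.
    by case: u u1 u2 {uB ltm} => /= ? ? -> ->.
  - by rewrite /sg; case: ifPn => [?|]; rewrite ?mul1r// mulN1r -ltNge; lra.
  - by rewrite /sg; case: ifPn => [?|]; rewrite ?mul1r// mulN1r -ltNge; lra.
apply: ediam_le; first by rewrite divr_ge0.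
move=> y z [/= By yk [u [un u1 u2 uB]]] [/= Bz zk [v [vn v1 v2 vB]]].
rewrite (le_trans (euclid_dist_le_l1 _ _))//.
have /andP[? ?] := T2 b1 b2 y (B1 _ By); have /andP[? ?] := T2 b1 b2 z (B1 _ Bz).
have := @truncn_eq_dist _ _ _ _ _ (etrans yk (esym zk)).
rewrite -mulrBl normrM (@gtr0_norm _ (M / 4)) ?divr_gt0// -ler_pdivlMr ?divr_gt0//.
rewrite mul1r invf_div => TT.
apply: le_trans (TT _ _); last 2 first.
- by rewrite mulr_ge0 ?divr_ge0 ?(ltW M0)//; lra.
- by rewrite mulr_ge0 ?divr_ge0 ?(ltW M0)//; lra.
have -> : T b1 b2 y + 2 - (T b1 b2 z + 2) =
    sg b1 * (y.1 - z.1) - sg b2 * (y.2 - z.2) by rewrite /T; ring.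
rewrite -(sgn b1 (y.1 - z.1)) -(sgn b2 (y.2 - z.2)).
apply: (@antimonotone_dist _ _ _ (sg b1 * v.1) (sg b2 * v.2)
  (sg b1 * u.1) (sg b2 * u.2)) => //; rewrite ?sg0 ?sgM//.
- exact: vB.
- have := uB _ Bz; lra.
Qed.

Lemma hausdorff1_delta_le (R : realType) (T : finType) (U : T -> set (plane R))
    (A : set (plane R)) (delta e : R) : 0 <= e -> e <= delta ->
  A `<=` \bigcup_t U t -> (forall t, (ediam (U t) <= e%:E)%E) ->
  (hausdorff1_delta delta A <= (#|T|%:R * e)%:E)%E.
Proof.
move=> e0 ed AU Ue; pose s := [seq U t | t <- enum T].
have s_e i : (ediam (nth set0 s i) <= e%:E)%E.
  have [lt_i|ge_i] := ltnP i (size s); last first.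
    by rewrite nth_default//; apply: ediam_le.
  have : nth set0 s i \in s by exact: mem_nth.
  by move=> /mapP[t _ ->]; exact: Ue.
apply: (@le_trans _ _ (\sum_(0 <= i <oo) ediam (nth set0 s i))%E).
  apply: ereal_inf_lbound; exists (nth set0 s) => //; split.
    move=> y /AU[t _ Uty]; exists (index t (enum T)) => //.
    by rewrite (nth_map t) ?index_mem ?mem_enum// nth_index ?mem_enum.
  by move=> i; rewrite (le_trans (s_e i))// lee_fin.
rewrite (nneseries_split _ (#|T|)); last by move=> k _; exact: ediam_ge0.
rewrite add0n [X in (_ + X)%E]eseries0 ?adde0; last first.
  move=> i iT _; rewrite nth_default; last by rewrite size_map -cardE.
  apply/le_anti/andP; split; last exact: ediam_ge0.
  by apply: ediam_le.
apply: (@le_trans _ _ (\sum_(0 <= i < #|T|) e%:E)%E).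
  by apply: lee_sum => i _; exact: s_e.
by rewrite sumEFin sumr_const_nat subn0 mulr_natl.
Qed.

Lemma hausdorff1_ge0 (R : realType) (A : set (plane R)) : (0 <= hausdorff1 A)%E.
Proof.
apply: (@le_trans _ _ (hausdorff1_delta 1 A)).
  apply: le_ereal_inf_tmp => _ [U _ <-].
  by apply: nneseries_ge0 => n _ _; exact: ediam_ge0.
by rewrite /hausdorff1; apply: ereal_sup_ubound; exists 1 => //=.
Qed.

(** * Length of a Voronoi tessellation in the unit disk *)

(** A cell is an intersection of closed half-planes, so nothing is lost by
    passing to its closure. *)
Lemma voronoi_boundary_nearest (R : realType) (I : set nat)
    (x : nat -> plane R) (i : nat) (y : plane R) : I i ->
  boundary (voronoi_cell I x i) y ->
  forall j, I j -> euclid_dist y (x i) <= euclid_dist y (x j).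
Proof.
move=> Ii [cl _] j Ij; apply/ler_addgt0Pr => e e0.
have [z /(voronoi_cellP _ _ Ii)/(_ j Ij) zij yz] :=
  closure_euclid cl (divr_gt0 e0 (ltr0n R 2)).
have := euclid_dist_triangle y z (x i); have := euclid_dist_triangle z y (x j).
rewrite (euclid_distC z y); lra.
Qed.

Lemma seq_gap (R : realType) (s : seq nat) (f : nat -> R) :
  (forall j, j \in s -> 0 < f j) ->
  exists2 e, 0 < e & forall j, j \in s -> e <= f j.
Proof.
elim: s => [|a s IH] f0; first by exists 1.
have [j js|e e0 es] := IH; first by apply: f0; rewrite inE js orbT.
exists (Num.min e (f a)).
  by rewrite lt_min e0 f0// mem_head.
move=> j; rewrite inE ge_min => /predU1P[->|/es ->//].
by rewrite lexx orbT.
Qed.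

(** By local finiteness only finitely many points compete for being nearest to
    [y]. If all of those different from [x i] lost strictly,
    they would lose by a uniform margin and a neighbourhood of [y] would lie in
    the cell. *)
Lemma voronoi_boundary_tie (R : realType) (I : set nat)
    (x : nat -> plane R) (i : nat) (y : plane R) :
  locally_finite (counting_of I x) -> I i ->
  boundary (voronoi_cell I x i) y ->
  exists2 j, I j & x j <> x i /\ euclid_dist y (x i) = euclid_dist y (x j).
Proof.
move=> lf Ii yb; apply: contrapT => notie.
have gap j : I j -> x j <> x i -> euclid_dist y (x i) < euclid_dist y (x j).
  move=> Ij xji; rewrite lt_neqAle (voronoi_boundary_nearest Ii yb Ij) andbT.
  by apply/eqP => yij; apply: notie; exists j.
set r := euclid_dist y (x i) in gap *.
pose rho := euclid_dist y (0, 0) + r + 1.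
have [/finite_seqP[s sE] _] := counting_of_card (lf rho).
have sP j : j \in s <-> I j /\ disk rho (x j).
  by have := congr1 (@^~ j) sE; rewrite /= => ->.
have [|e e0 es] := @seq_gap R s
    (fun j => if x j == x i then 1 else euclid_dist y (x j) - r).
  move=> j /sP[Ij _]; case: ifPn => // /eqP xji; rewrite subr_gt0; exact: gap.
case: yb => _; apply; set d := Num.min e 1.
have d0 : 0 < d by rewrite lt_min e0 ltr01.
have de : d <= e by rewrite ge_min lexx.
have d1 : d <= 1 by rewrite ge_min lexx orbT.
apply: (@interior_euclid _ _ _ (d / 2)); first by rewrite divr_gt0.
move=> z yz; apply/(voronoi_cellP _ _ Ii) => j Ij.
have [->//|/eqP xji] := eqVneq (x j) (x i).
have h1 := euclid_dist_triangle z y (x i); rewrite (euclid_distC z y) in h1.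
have h2 := euclid_dist_triangle y z (x j).
suff : r + d <= euclid_dist y (x j) by rewrite -/r in h1; lra.
have [js|js] := boolP (j \in s).
  by have := es _ js; rewrite ifF; [lra|exact/eqP].
have : ~~ (euclid_dist (x j) (0, 0) <= rho).
  by apply: contra js => xjr; apply/sP.
rewrite -ltNge => xjr; have := euclid_dist_triangle (x j) y (0, 0).
rewrite (euclid_distC (x j) y); rewrite /rho in xjr; lra.
Qed.

Lemma bisector_halfplane (R : realType) (a b y z : plane R) :
  euclid_dist y a = euclid_dist y b -> euclid_dist z a <= euclid_dist z b ->
  (b.1 - a.1) * (z.1 - y.1) + (b.2 - a.2) * (z.2 - y.2) <= 0.
Proof.
move=> /(congr1 (fun t => t ^+ 2)); rewrite !euclid_dist_sqr => yab.
rewrite -ler_sqr ?nnegrE ?euclid_dist_ge0// !euclid_dist_sqr => zab.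
nra.
Qed.

(** The outer normal at [y] points from [x i] to the point tied with it. *)
Lemma voronoi_boundary_supported (R : realType) (I : set nat)
    (x : nat -> plane R) (i : nat) :
  locally_finite (counting_of I x) -> I i ->
  supported (boundary (voronoi_cell I x i) `&` disk 1).
Proof.
move=> lf Ii y [yb y1]; have [j Ij [xji yij]] := voronoi_boundary_tie lf Ii yb.
exists ((x j).1 - (x i).1, (x j).2 - (x i).2).
  case=> /eqP; rewrite subr_eq0 => /eqP e1 /eqP; rewrite subr_eq0 => /eqP e2.
  by apply: xji; case: (x j) (x i) e1 e2 => ? ? [? ?] /= -> ->.
move=> z [zb _]; apply: (bisector_halfplane yij).
exact: (voronoi_boundary_nearest Ii zb).
Qed.

(** Linear in the number of points, although the number of pairs of points, and
    so of bisectors, is quadratic: each cell is convex and contributes a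
    bounded length to the unit disk. A quadratic bound would not do, since the
    square of a Poisson variable has no exponential moment. The constant
    comes from 4 quadrants, [m + 2] intervals, and a mesh of [4 / (m + 1)]. *)
Lemma voronoi_length (R : realType) (I : set nat) (x : nat -> plane R)
    (A : set (plane R)) :
  locally_finite (counting_of I x) -> (counting_of I x A < +oo)%E ->
  (forall i y, I i -> boundary (voronoi_cell I x i) y -> disk 1 y -> A (x i)) ->
  (hausdorff1 (voronoi I x `&` disk 1) <= 32%:E * counting_of I x A)%E.
Proof.
move=> lf Afin relevant; have [finD ->] := counting_of_card Afin.
set F := fset_set _.
apply: ge_ereal_sup => _ [delta /= d0 <-].
set m := Num.truncn (4 / delta).
have md : 4 / m.+1%:R <= delta.
  rewrite ler_pdivrMr ?ltr0n// mulrC -ler_pdivrMr//.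
  by rewrite ltW// truncnS_gt.
have cover i : exists V : bool * bool * 'I_m.+2 -> set (plane R), I i ->
    boundary (voronoi_cell I x i) `&` disk 1 `<=` \bigcup_t V t /\
    forall t, (ediam (V t) <= (4 / m.+1%:R)%:E)%E.
  have [Ii|nIi] := pselect (I i); last by exists (fun=> set0).
  have [V ?] := supported_cover m (voronoi_boundary_supported lf Ii)
    (@subIsetr _ _ _).
  by exists V.
have {cover}[V VP] := choice cover.
have FI (f : F) : I (val f).
  by have := valP f; rewrite in_fset_set// => /set_mem[].
apply: le_trans (@hausdorff1_delta_le _
  (F * (bool * bool * 'I_m.+2))%type (fun t => V (val t.1) t.2) _ _
  _ _ md _ _) _.
- by rewrite divr_ge0.
- move=> y [[i Ii yb] y1].
  have iF : i \in F.
    by rewrite in_fset_set//; apply/mem_set; split => //; exact: relevant yb y1.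
  have [+ _] := VP i Ii; move=> /(_ y (conj yb y1))[t _ Vt].
  by exists ([` iF]%fset, t).
- by move=> [f t] /=; exact: (VP _ (FI f)).2.
rewrite !card_prod card_bool card_ord -cardfE lee_fin.
rewrite !natrM -[m.+2%:R]natr1 (mulrC 32) -!mulrA ler_wpM2l//.
rewrite !mulrA ler_pdivrMr ?ltr0n//.
have : 1 <= m.+1%:R :> R by rewrite ler1n.
lra.
Qed.

(** A point of [disk 1] has a point of the process within distance [r + 1], so
    its nearest points are in [disk (r + 2)]. *)
Lemma voronoi_length_near (R : realType) (I : set nat) (x : nat -> plane R)
    (r : R) (A : set (plane R)) :
  locally_finite (counting_of I x) -> (counting_of I x (disk r) != 0)%E ->
  (forall i, I i -> disk (r + 2) (x i) -> A (x i)) ->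
  (counting_of I x A < +oo)%E ->
  (hausdorff1 (voronoi I x `&` disk 1) <= 32%:E * counting_of I x A)%E.
Proof.
move=> lf cr rA Afin; apply: voronoi_length => // i y Ii yb y1; apply: rA => //.
have [j [Ij xjr]] : exists j, I j /\ disk r (x j).
  apply: contrapT => nj; move/eqP: cr; apply; rewrite counting_ofE.
  by apply: esum1 => j [Ij xjr]; exfalso; apply: nj; exists j.
rewrite /disk /= in y1 xjr *.
have := voronoi_boundary_nearest Ii yb Ij.
have := euclid_dist_triangle (x i) y (0, 0).
have := euclid_dist_triangle y (0, 0) (x j).
rewrite (euclid_distC (0, 0) (x j)) (euclid_distC (x i) y); lra.
Qed.

Lemma counting_of_eq0 (R : realType) (I : set nat) (x : nat -> plane R)
    (A : set (plane R)) i :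
  counting_of I x A = 0%E -> I i -> ~ A (x i).
Proof.
move=> c0 Ii Axi; have : (1 <= counting_of I x A)%E.
  rewrite counting_ofE; apply: esum_ge; exists [set i]; last by rewrite fsbig_set1.
  by split => // _ ->.
by rewrite c0 lee_fin ler10.
Qed.

(** * Areas of disks and annuli *)

(** The integral of a nonnegative function is defined as a supremum over simple
    functions below it, so it is monotone even for functions that are not
    measurable. The length of the tessellation can thus be bounded from above
    without regard to its measurability as a function of the sample. *)
Lemma ge0_le_integralT d (T : measurableType d) (R : realType)
    (mu : {measure set T -> \bar R}) (f g : T -> \bar R) :
  (forall x, (0 <= f x)%E) -> (forall x, (f x <= g x)%E) ->
  (\int[mu]_x f x <= \int[mu]_x g x)%E.
Proof.
move=> f0 fg; have g0 x : (0 <= g x)%E := le_trans (f0 x) (fg x).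
rewrite !ge0_integralTE//; apply: le_ereal_sup => _ [h /= hf <-].
by exists h => // x; exact: le_trans (hf x) (fg x).
Qed.

Lemma diskE (R : realType) (r : R) : 0 <= r ->
  disk r = [set y : plane R | y.1 ^+ 2 + y.2 ^+ 2 <= r ^+ 2].
Proof.
move=> r0; have E (y : plane R) :
    (euclid_dist y (0, 0) <= r) = (y.1 ^+ 2 + y.2 ^+ 2 <= r ^+ 2).
  by rewrite -ler_sqr ?nnegrE ?euclid_dist_ge0// euclid_dist_sqr !subr0.
by apply/seteqP; split => y; rewrite /disk /= E.
Qed.

Lemma measurable_disk (R : realType) (r : R) : 0 <= r ->
  measurable (disk r : set (plane R)).
Proof.
move=> r0; rewrite diskE//.
pose f (y : plane R) : measurableTypeR R := y.1 ^+ 2 + y.2 ^+ 2.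
have mf : measurable_fun setT f.
  by apply: measurable_funD; apply: measurable_funX.
rewrite (_ : [set y | _] = setT `&` f @^-1` `]-oo, r ^+ 2]); first exact: mf.
by apply/seteqP; split => y /=; rewrite in_itv//=; case.
Qed.

Lemma disk_subset (R : realType) (r s : R) : r <= s ->
  (disk r : set (plane R)) `<=` disk s.
Proof. by move=> rs y; rewrite /disk /= => /le_trans; exact. Qed.

Definition rectangle (R : realType) (a b c e : R) : set (plane R) :=
  [set` `[a, b]] `*` [set` `[c, e]].

Lemma lebesgue_measure_segment (R : realType) (a b : R) : a <= b ->
  lebesgue_measure (`[a, b] : set R) = (b - a)%:E.
Proof.
rewrite lebesgue_measure_itv /= lte_fin le_eqVlt => /predU1P[->|->].
  by rewrite ltxx subrr.
by rewrite EFinB.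
Qed.

Lemma area_rectangle (R : realType) (a b c e : R) : a <= b -> c <= e ->
  area (rectangle a b c e) = ((b - a) * (e - c))%:E.
Proof.
move=> ab ce; rewrite EFinM -!lebesgue_measure_segment//.
exact: product_measure1E.
Qed.

Lemma measurable_rectangle (R : realType) (a b c e : R) :
  measurable (rectangle a b c e).
Proof. exact: measurableX. Qed.

Lemma le_area (R : realType) (A B : set (plane R)) :
  measurable A -> measurable B -> A `<=` B -> (area A <= area B)%E.
Proof.
move=> mA mB AB.
pose mu : {measure set (plane R) -> \bar R} :=
  (@lebesgue_measure R \x @lebesgue_measure R)%E.
by apply: (le_measure mu) => //; exact/mem_set.
Qed.

Lemma area_disk_bounds (R : realType) (r : R) : 0 <= r ->
  ((r ^+ 2 / 4)%:E <= area (disk r : set (plane R)) <= (4 * r ^+ 2)%:E)%E.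
Proof.
move=> r0; apply/andP; split.
  have -> : r ^+ 2 / 4 = (r / 2 - 0) * (r / 2 - 0) by field.
  rewrite -area_rectangle ?divr_ge0//; apply: le_area.
  - exact: measurable_rectangle.
  - exact: measurable_disk.
  - move=> [a b] [/=]; rewrite !in_itv/= diskE//= => /andP[? ?] /andP[? ?].
    nra.
have -> : 4 * r ^+ 2 = (r - - r) * (r - - r) by ring.
rewrite -area_rectangle ?ge0_cp//; apply: le_area.
- exact: measurable_disk.
- exact: measurable_rectangle.
- move=> y yr; split; rewrite /= in_itv/= -ler_norml.
    by have := le_euclid_dist1 y (0, 0); rewrite subr0 => /le_trans; exact.
  by have := le_euclid_dist2 y (0, 0); rewrite subr0 => /le_trans; exact.
Qed.

Definition annulus (R : realType) (n : nat) : set (plane R) :=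
  disk (n + 4)%N%:R `\` disk n%:R.

Lemma measurable_annulus (R : realType) n : measurable (@annulus R n).
Proof. by apply: measurableD; exact: measurable_disk. Qed.

Lemma rectangle_sub_annulus (R : realType) (n : nat) :
  rectangle (n%:R + 1 : R) (n%:R + 2) 0 1 `<=` annulus n.
Proof.
have n0 : 0 <= n%:R :> R by [].
move=> [a b]; rewrite /rectangle /annulus !diskE// => -[/=].
rewrite !in_itv/= natrD => /andP[? ?] /andP[? ?]; split; first nra.
by apply/negP; rewrite -ltNge; nra.
Qed.

Lemma area_annulus_gt0 (R : realType) (n : nat) : (0 < area (@annulus R n))%E.
Proof.
apply: (@lt_le_trans _ _ (area (rectangle (n%:R + 1 : R) (n%:R + 2) 0 1))).
  rewrite area_rectangle ?lerD2l ?ler1n//.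
  by rewrite lte_fin mulr_gt0//; lra.
apply: le_area; [exact: measurable_rectangle|exact: measurable_annulus|].
exact: rectangle_sub_annulus.
Qed.

Lemma xsection_annulus (R : realType) (n : nat) (t : R) :
  let a := Num.sqrt (n%:R ^+ 2 - t ^+ 2) in
  let b := Num.sqrt ((n + 4)%:R ^+ 2 - t ^+ 2) in
  xsection (@annulus R n) t `<=` `[- b, - a] `|` `[a, b].
Proof.
move=> a b y /xsectionP; rewrite /annulus !diskE// => -[/= yb /negP].
rewrite -ltNge => ya.
have yb' : `|y| <= b by rewrite -sqrtr_sqr ler_wsqrtr//; lra.
have ya' : a <= `|y| by rewrite -(@sqrtr_sqr _ y) ler_wsqrtr//; lra.
case: (leP 0 y) ya' yb' => y0 ya' yb'; [right|left]; rewrite /= in_itv /=.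
  by rewrite ger0_norm in ya' yb' => //; apply/andP.
by rewrite ltr0_norm in ya' yb' => //; apply/andP; lra.
Qed.

Lemma sqrtrB_le (R : realType) (u k : R) : 0 <= k ->
  Num.sqrt (u + k) - Num.sqrt u <= Num.sqrt k.
Proof.
move=> k0; rewrite lerBlDr -(@ler_pXn2r _ 2)// ?nnegrE ?addr_ge0 ?sqrtr_ge0//.
rewrite sqrrD (sqr_sqrtr k0).
have sk : 0 <= Num.sqrt k * Num.sqrt u by rewrite mulr_ge0 ?sqrtr_ge0.
have [u0|u0] := leP 0 u.
  rewrite !sqr_sqrtr//; lra.
have := sqr_ge0 (Num.sqrt u).
have [uk|uk] := leP 0 (u + k); first by rewrite (sqr_sqrtr uk); lra.
by rewrite (ltr0_sqrtr uk) expr0n /=; lra.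
Qed.

(** Fubini: by [sqrtrB_le], every vertical section consists of two intervals of
    length at most [sqrt ((n + 4)^2 - n^2)]. The resulting order [n^(3/2)] is
    not sharp, but it is smaller than the order [n^2] of the area of the
    disk. *)
Lemma area_annulus_le (R : realType) (n : nat) :
  (area (@annulus R n) <= (4 * (n + 4)%:R * Num.sqrt (8 * n%:R + 16))%:E)%E.
Proof.
have n0 : 0 <= n%:R :> R by [].
set k := Num.sqrt _; set r : R := (n + 4)%:R.
rewrite /area /product_measure1.
apply: (@le_trans _ _ (\int[@lebesgue_measure R]_t
    ((2 * k) * \1_(`[- r, r] : set R) t)%:E)%E).
  apply: ge0_le_integralT => [t|t]; first exact: measure_ge0.
  rewrite /= indicE; have [|] := boolP (t \in _).
    move=> _; rewrite mulr1.
    set a := Num.sqrt (n%:R ^+ 2 - t ^+ 2).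
    set b := Num.sqrt (r ^+ 2 - t ^+ 2).
    have bak : b - a <= k.
      rewrite /b /a /k (_ : r ^+ 2 - t ^+ 2 =
        n%:R ^+ 2 - t ^+ 2 + (8 * n%:R + 16)); first by apply: sqrtrB_le; lra.
      by rewrite /r natrD; ring.
    have ab : a <= b.
      by apply: ler_wsqrtr; rewrite lerD2r ler_sqr ?nnegrE// ler_nat leq_addr.
    pose J1 : set R := `[- b, - a]%classic; pose J2 : set R := `[a, b]%classic.
    apply: (@le_trans _ _ (lebesgue_measure J1 + lebesgue_measure J2)%E).
      apply: le_trans (measureU2 _ _ _) ; last 2 first.
      - exact: measurable_itv.
      - exact: measurable_itv.
      apply: le_measure.
      - apply/mem_set; exact: (@measurable_xsection _ _ (measurableTypeR R)
          (measurableTypeR R) _ t (@measurable_annulus R n)).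
      - apply/mem_set; apply: measurableU; exact: measurable_itv.
      - exact: xsection_annulus.
    rewrite /J1 /J2 !lebesgue_measure_segment ?lerN2// -EFinD lee_fin; lra.
  move=> /negP tr; rewrite mulr0 (_ : xsection _ _ = set0) ?measure0//.
  apply/seteqP; split => // y /xsectionP[yr _].
  apply: tr; apply/mem_set; rewrite /= in_itv /= -ler_norml.
  by have := le_euclid_dist1 (t, y) (0, 0); rewrite subr0 => /le_trans; exact.
under eq_integral do rewrite EFinM.
rewrite ge0_integralZl//; last 2 first.
- by apply/measurable_EFinP; exact: measurable_indic.
- by rewrite lee_fin mulr_ge0 ?sqrtr_ge0.
rewrite integral_indic// setIT.
apply: (@le_trans _ _ ((2 * k)%:E * (r - - r)%:E)%E).
  by rewrite -lebesgue_measure_segment ?ge0_cp//; exact: lexx.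
by rewrite -EFinM lee_fin; lra.
Qed.

(** * From logarithmic rates to exponential bounds *)

Lemma limn_esup_lt_eventually (R : realType) (u : (\bar R)^nat) (c : \bar R) :
  (limn_esup u < c)%E -> exists s N, (s < c)%E /\
    forall n, (N <= n)%N -> (u n <= s)%E.
Proof.
move=> /ereal_inf_lt[_ [V [N _ NV] <-] Vc].
exists (ereal_sup (u @` V)), N; split=> // n Nn.
by apply: ereal_sup_ubound; exists n => //; exact: NV.
Qed.

(** Undoes the normalized logarithm of the two hypotheses on the random
    intensity. *)
Lemma le_expR_of_rate (R : realType) (r M : R) (Z : \bar R) : 0 < r ->
  (0 <= Z)%E -> ((r%:E)^-1 * lne Z <= M%:E)%E -> (Z <= (expR (r * M))%:E)%E.
Proof.
move=> r0 Z0; rewrite inver gt_eqF// lee_pdivrMl// => ZM.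
have /eqP <- : expeR (lne Z) == Z by rewrite lneK_eq.
by rewrite (_ : (expR _)%:E = expeR (r * M)%:E)// lee_expeR EFinM.
Qed.

Lemma area_fin (R : realType) (A : set (plane R)) (a : R) :
  (0 < area A)%E -> (area A <= a%:E)%E ->
  exists2 r, 0 < r & area A = r%:E.
Proof.
case: (area A) => [r| |]//; first by rewrite lte_fin => r0 _; exists r.
Qed.

Lemma void_rate (R : realType) (Z : nat -> \bar R) :
  (forall n, (0 <= Z n)%E) ->
  (limn_esup (fun n : nat => (area (disk n%:R : set (plane R)))^-1 * lne (Z n))
    < 0)%E ->
  exists2 c, 0 < c &
    exists N, forall n, (N <= n)%N -> (Z n <= (expR (- (c * n%:R ^+ 2)))%:E)%E.
Proof.
move=> Z0 /limn_esup_lt_eventually[s [N [s0 sN]]].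
have [c c0 sc] : exists2 c, 0 < c & (s <= (- c)%:E)%E.
  case: s s0 {sN} => [s| |]//.
    by rewrite lte_fin => s0; exists (- s); rewrite ?oppr_gt0// opprK.
  by exists 1 => //; exact: leNye.
exists (c / 4); first by rewrite divr_gt0.
exists (maxn N 1) => n; rewrite geq_max => /andP[Nn n1].
have n0 : 0 < n%:R :> R by rewrite ltr0n.
have /andP[lb ub] := @area_disk_bounds R n%:R (ltW n0).
have [|r r0 rE] := @area_fin _ (disk n%:R) _ _ ub.
  by apply: lt_le_trans lb; rewrite lte_fin divr_gt0// exprn_gt0.
have := le_trans (sN _ Nn) sc; rewrite rE => /(le_expR_of_rate r0 (Z0 n)).
move=> /le_trans; apply; rewrite lee_fin ler_expR.
by rewrite rE lee_fin in lb; nra.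
Qed.

Lemma annulus_rate (R : realType) (Z : nat -> \bar R) :
  (forall n, (0 <= Z n)%E) ->
  (limn_esup (fun n : nat => (area (@annulus R n))^-1 * lne (Z n))
    < +oo)%E ->
  exists2 M : R, 0 <= M & exists N, forall n, (N <= n)%N ->
    (Z n <= (expR (M * (4 * (n + 4)%:R * Num.sqrt (8 * n%:R + 16))))%:E)%E.
Proof.
move=> Z0 /limn_esup_lt_eventually[s [N [s0 sN]]].
have [M M0 sM] : exists2 M : R, 0 <= M & (s <= M%:E)%E.
  case: s s0 {sN} => [s| |]//; last by exists 0; rewrite ?leNye.
  by exists (Num.max s 0); rewrite ?lee_fin le_max lexx// orbT.
exists M => //; exists N => n Nn.
have [r r0 rE] := area_fin (area_annulus_gt0 R n) (area_annulus_le R n).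
have := le_trans (sN _ Nn) sM; rewrite rE => /(le_expR_of_rate r0 (Z0 n)).
move=> /le_trans; apply; rewrite lee_fin ler_expR mulrC ler_wpM2l//.
by have := area_annulus_le R n; rewrite rE.
Qed.

(** With [t := sqrt n] the left-hand side is at most [32 * t ^ 3] once [n >= 4],
    and [e * n ^ 2] is [e * t ^ 4]. *)
Lemma annulus_area_negligible (R : realType) (e : R) : 0 < e ->
  exists N, forall n, (N <= n)%N ->
    4 * (n + 4)%:R * Num.sqrt (8 * n%:R + 16) <= e * n%:R ^+ 2.
Proof.
move=> e0; exists (maxn 4 (Num.truncn ((32 / e) ^+ 2)).+1) => n.
rewrite geq_max => /andP[n4 ne].
have {}n4 : 4 <= n%:R :> R by rewrite ler_nat.
have {}ne : (32 / e) ^+ 2 <= n%:R.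
  by rewrite (le_trans (ltW (truncnS_gt _)))// ler_nat.
rewrite natrD; set t := Num.sqrt (n%:R : R).
have t0 : 0 <= t by exact: sqrtr_ge0.
have tE : n%:R = t ^+ 2 :> R by rewrite sqr_sqrtr.
have s4 : Num.sqrt (8 * n%:R + 16) <= 4 * t.
  rewrite -(@ler_pXn2r _ 2)// ?nnegrE ?sqrtr_ge0 ?mulr_ge0//.
  rewrite sqr_sqrtr; last lra.
  rewrite exprMn -tE; lra.
have et : 32 <= e * t.
  rewrite -ler_pdivrMl// mulrC -(@ler_pXn2r _ 2)// ?nnegrE ?divr_ge0 ?(ltW e0)//.
  by rewrite -tE.
apply: (@le_trans _ _ (32 * n%:R * t)); last first.
  rewrite expr2 mulrA [X in _ <= X](_ : _ = (e * t) * n%:R * t); last first.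
    by rewrite {2}tE; ring.
  by rewrite ler_wpM2r// ler_wpM2r.
apply: (@le_trans _ _ (8 * n%:R * (4 * t))); last by lra.
by apply: ler_pM => //; rewrite ?mulr_ge0 ?sqrtr_ge0//; lra.
Qed.

(** * Moments of counts *)

(** Counts are finite on bounded sets; a real value can be composed with the
    exponential function on the reals, whose measurability is at hand. *)
Definition npoints d (Omega : measurableType d) (R : realType)
    (I : Omega -> set nat) (x : Omega -> nat -> plane R)
    (A : set (plane R)) (w : Omega) : R :=
  fine (counting_of (I w) (x w) A).

Definition bounded_in_disk (R : realType) (A : set (plane R)) : Prop :=
  exists r : R, A `<=` disk r.

Definition exp_moments d (Omega : measurableType d) (R : realType)
    (P : probability Omega R) (I : Omega -> set nat)
    (x : Omega -> nat -> plane R) (A : set (plane R)) : Prop :=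
  forall b : R, 0 < b ->
    (\int[P]_w (expR (b * npoints I x A w))%:E < +oo)%E.

Lemma expR_nneseries (R : realType) (y : R) : 0 <= y ->
  (\sum_(n <oo) (exp_coeff y n)%:E)%E = (expR y)%:E.
Proof.
move=> y0; apply/cvg_lim => //.
rewrite (_ : (fun n => _) = EFin \o series (exp_coeff y)).
  by apply: cvg_EFin; [exact: nearW|exact: is_cvg_series_exp_coeff].
by apply/funext => n /=; rewrite sumEFin.
Qed.

Lemma poisson_exp_moment (R : realType) (r b : R) : 0 <= r ->
  (\sum_(n <oo) (expR (b * n%:R) * poisson_mass r n)%:E)%E =
  (expR ((expR b - 1) * r))%:E.
Proof.
move=> r0; rewrite (_ : (expR b - 1) * r = - r + expR b * r); last by ring.
rewrite expRD EFinM -(@expR_nneseries _ (expR b * r)) ?mulr_ge0 ?expR_ge0//.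
rewrite -nneseriesZl//; last first.
  by move=> n _; rewrite lee_fin exp_coeff_ge0 ?mulr_ge0 ?expR_ge0.
apply: eq_eseriesr => n _; rewrite -EFinM; congr EFin.
by rewrite /poisson_mass /exp_coeff /= exprMn expRM_natr; ring.
Qed.

(** Laws of counts are handled through the probabilities of single values; this
    turns them into expectations. *)
Lemma integral_levels d (Omega : measurableType d) (R : realType)
    (mu : {measure set Omega -> \bar R}) (N : Omega -> \bar R) (g : R -> R) :
  measurable_fun setT N -> (forall w, exists n : nat, N w = n%:R%:E) ->
  measurable_fun setT g -> (forall y, 0 <= g y) ->
  (\int[mu]_w (g (fine (N w)))%:E =
   \sum_(n <oo) (g n%:R)%:E * mu [set w | N w = n%:R%:E])%E.
Proof.
move=> mN natN mg g0.
pose F n : set Omega := [set w | N w = n%:R%:E].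
have mF n : measurable (F n).
  rewrite (_ : F n = setT `&` N @^-1` [set n%:R%:E]); first exact: mN.
  by rewrite setTI.
have FT : \bigcup_n F n = setT.
  by apply/seteqP; split => // w _; have [n ?] := natN w; exists n.
have tF : trivIset setT F.
  move=> i j _ _ [w []]; rewrite /F /= => -> /eqP.
  by rewrite eqe eqr_nat => /eqP.
rewrite -[X in integral _ X _]FT ge0_integral_bigcup//; last 2 first.
- rewrite FT; apply/measurable_EFinP; apply: measurableT_comp => //.
  exact: measurableT_comp.
- by move=> w _; rewrite lee_fin.
apply: eq_eseriesr => n _; rewrite -integral_cst; last exact: mF.
by apply: eq_integral => w /set_mem /= ->.
Qed.

Section point_process.
Context d (Omega : measurableType d) (R : realType) (P : probability Omega R).
Variables (I : Omega -> set nat) (x : Omega -> nat -> plane R).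
Hypothesis pp : is_point_process I x.
Implicit Types A B : set (plane R).

Lemma counting_of_fin w A : bounded_in_disk A ->
  counting_of (I w) (x w) A = (npoints I x A w)%:E.
Proof.
move=> [r Ar]; rewrite fineK// ge0_fin_numE; last by apply: esum_ge0.
by rewrite (le_lt_trans (counting_of_subset _ _ Ar))//; exact: pp.2.
Qed.

Lemma counting_of_nat w A : bounded_in_disk A ->
  exists n : nat, counting_of (I w) (x w) A = n%:R%:E.
Proof.
move=> [r Ar]; have [] := @counting_of_card R (I w) (x w) A.
  by rewrite (le_lt_trans (counting_of_subset _ _ Ar))//; exact: pp.2.
by move=> _ ->; eexists.
Qed.

Lemma measurable_npoints A : measurable A ->
  measurable_fun setT (npoints I x A).
Proof. by move=> mA; apply: measurableT_comp => //; exact: pp.1. Qed.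

Lemma le_npoints w A B : bounded_in_disk B -> A `<=` B ->
  npoints I x A w <= npoints I x B w.
Proof.
move=> bB AB; have bA : bounded_in_disk A.
  by have [r Br] := bB; exists r; exact: subset_trans Br.
by rewrite -lee_fin -!counting_of_fin// counting_of_subset.
Qed.

Lemma measurable_exp_npoints A b : measurable A ->
  measurable_fun setT (fun w => (expR (b * npoints I x A w))%:E : \bar R).
Proof.
move=> mA; apply/measurable_EFinP; apply: measurableT_comp => //.
by apply: measurable_funM => //; exact: measurable_npoints.
Qed.

Lemma exp_npoints_levels A b : measurable A -> bounded_in_disk A ->
  (\int[P]_w (expR (b * npoints I x A w))%:E =
   \sum_(n <oo) (expR (b * n%:R))%:E *
     P [set w | counting_of (I w) (x w) A = n%:R%:E])%E.
Proof.
move=> mA bA; apply: (@integral_levels _ _ _ P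
  (fun w => counting_of (I w) (x w) A) (fun y => expR (b * y))).
- exact: pp.1.
- by move=> w; exact: counting_of_nat.
- by apply: measurableT_comp => //; exact: measurable_funM.
- by move=> y; exact: expR_ge0.
Qed.

Lemma exp_moments_subset A B : A `<=` B -> bounded_in_disk B ->
  exp_moments P I x B -> exp_moments P I x A.
Proof.
move=> AB bB mB b b0; apply: le_lt_trans (mB b b0).
apply: ge0_le_integralT => w; rewrite lee_fin ?expR_ge0//.
by rewrite ler_expR ler_pM2l// le_npoints.
Qed.

(** For [s <= t], [expR (b * (s + t)) <= expR (b * 2 * t)]: doubling the
    exponent takes the place of the Cauchy-Schwarz inequality. *)
Lemma exp_momentsU A B : measurable A -> measurable B ->
  bounded_in_disk A -> bounded_in_disk B ->
  exp_moments P I x A -> exp_moments P I x B -> exp_moments P I x (A `|` B).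
Proof.
move=> mA mB bA bB eA eB b b0.
have bAB : bounded_in_disk (A `|` B).
  case: bA bB => r Ar [s Bs]; exists (Num.max r s) => y [/Ar|/Bs].
    by apply/disk_subset; rewrite le_max lexx.
  by apply/disk_subset; rewrite le_max lexx orbT.
have b20 : 0 < b * 2 by rewrite mulr_gt0.
apply: (@le_lt_trans _ _ (\int[P]_w ((expR (b * 2 * npoints I x A w))%:E +
    (expR (b * 2 * npoints I x B w))%:E))%E); last first.
  rewrite ge0_integralD//.
  - by apply: lte_add_pinfty; [exact: eA|exact: eB].
  - exact: measurable_exp_npoints.
  - exact: measurable_exp_npoints.
apply: ge0_le_integralT => w; first by rewrite lee_fin expR_ge0.
have : npoints I x (A `|` B) w <= npoints I x A w + npoints I x B w.
  by rewrite -lee_fin EFinD -!counting_of_fin// counting_ofU.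
move: (npoints _ _ _ _) (npoints I x A w) (npoints I x B w) => u s t ust.
rewrite -EFinD lee_fin.
have [st|ts] := leP s t.
  apply: ler_wpDl; first exact: expR_ge0.
  by rewrite ler_expR -mulrA ler_pM2l//; lra.
apply: ler_wpDr; first exact: expR_ge0.
by rewrite ler_expR -mulrA ler_pM2l//; lra.
Qed.

(** Translating the points by [t] amounts to translating the window by
    [- t]. *)
Lemma stationary_count t A n : stationary P I x -> measurable A ->
  P [set w | counting_of (I w) (x w)
               [set y | A (y.1 + t.1, y.2 + t.2)] = n%:R%:E] =
  P [set w | counting_of (I w) (x w) A = n%:R%:E].
Proof.
move=> st mA.
pose E : set (set (plane R) -> \bar R) := [set m | m A = n%:R%:E].
have sE : evaluation_sigma E.
  apply: sub_sigma_algebra; exists A => //.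
  by exists [set n%:R%:E] => //; rewrite setTI.
by rewrite -(st t E sE).
Qed.

Lemma exp_moments_shift t A b : stationary P I x -> measurable A ->
  bounded_in_disk A ->
  let A' := [set y | A (y.1 + t.1, y.2 + t.2)] in
  measurable A' -> bounded_in_disk A' ->
  (\int[P]_w (expR (b * npoints I x A' w))%:E =
   \int[P]_w (expR (b * npoints I x A w))%:E)%E.
Proof.
move=> st mA bA A' mA' bA'; rewrite !exp_npoints_levels//.
by apply: eq_eseriesr => n _; rewrite stationary_count.
Qed.

Section cox.
Variable Lambda : R.-ker Omega ~> plane R.
Hypothesis Lambda_lf : forall w, locally_finite (Lambda w).
Hypothesis X_cox : is_cox P Lambda I x.

Lemma Lambda_fin w A : measurable A -> bounded_in_disk A ->
  Lambda w A \is a fin_num.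
Proof.
move=> mA [r Ar]; rewrite ge0_fin_numE//.
have [r0|r0] := leP 0 r.
  apply: le_lt_trans (Lambda_lf w r); apply: le_measure => //.
    exact/mem_set.
  by apply/mem_set; exact: measurable_disk.
rewrite (_ : A = set0) ?measure0//; apply/seteqP; split => // y /Ar.
rewrite /disk /= => /(le_trans (euclid_dist_ge0 _ _)); lra.
Qed.

(** The case of one window and of the trivial conditioning event. *)
Lemma cox_count A n : measurable A -> bounded_in_disk A ->
  P [set w | counting_of (I w) (x w) A = n%:R%:E] =
  (\int[P]_w (poisson_mass (fine (Lambda w A)) n)%:E)%E.
Proof.
move=> mA bA; have [||| _] := X_cox (A := fun _ : 'I_1 => A) (fun _ => n).
- by [].
- by [].
- by move=> i j _ _ _; rewrite !ord1.
move=> /(_ setT) H; rewrite [in RHS](_ : (fun w => _) = fun w =>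
  (\prod_(i < 1) poisson_mass (fine (Lambda w A)) n)%:E); last first.
  by apply/funext => w; rewrite big_ord1.
rewrite -H.
  rewrite setIT; congr (P _); apply/seteqP; split => w //=.
  by move=> /(_ ord0).
exists setT; last by rewrite setTI.
by rewrite -[X in evaluation_sigma X]setD0; apply: sigma_algebraCD; exact: sigma_algebra0.
Qed.

End cox.
End point_process.

(** * Cox processes under the two conditions on the intensity *)

Section cox_voronoi.
Context d (Omega : measurableType d) (R : realType) (P : probability Omega R).
Variables (Lambda : R.-ker Omega ~> plane R).
Variables (I : Omega -> set nat) (x : Omega -> nat -> plane R).
Hypothesis Lambda_lf : forall w, locally_finite (Lambda w).
Hypothesis pp : is_point_process I x.
Hypothesis cox : is_cox P Lambda I x.

Lemma disk_bounded (r : R) : bounded_in_disk (disk r : set (plane R)).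
Proof. by exists r. Qed.

Lemma annulus_bounded n : bounded_in_disk (@annulus R n).
Proof. by exists (n + 4)%N%:R => y []. Qed.

Lemma measurable_intensity (A : set (plane R)) : measurable A ->
  measurable_fun setT (fun w => fine (Lambda w A)).
Proof. by move=> mA; apply: measurableT_comp => //; exact: measurable_kernel. Qed.

(** Exponential moments of the number of points with parameter [b] are those of
    the random intensity with parameter [expR b - 1]. *)
Lemma cox_exp_moment (A : set (plane R)) (b : R) : measurable A ->
  bounded_in_disk A ->
  (\int[P]_w (expR (b * npoints I x A w))%:E =
   \int[P]_w (expR ((expR b - 1) * fine (Lambda w A)))%:E)%E.
Proof.
move=> mA bA; rewrite (exp_npoints_levels P pp)//.
have mass_ge0 n w : 0 <= poisson_mass (fine (Lambda w A)) n.
  by rewrite /poisson_mass divr_ge0// mulr_ge0 ?expR_ge0// exprn_ge0// fine_ge0.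
have mmass n : measurable_fun setT
    (fun w => poisson_mass (fine (Lambda w A)) n).
  have mL := measurable_intensity mA.
  apply: measurable_funM => //; apply: measurable_funM.
    by apply: measurableT_comp => //; exact: measurableT_comp.
  exact: measurable_funX.
under [RHS]eq_integral => w _ do rewrite -poisson_exp_moment ?fine_ge0//.
rewrite integral_nneseries//; last 2 first.
- move=> n; apply/measurable_EFinP; exact: measurable_funM.
- by move=> n w _; rewrite lee_fin mulr_ge0 ?expR_ge0.
apply: eq_eseriesr => n _; rewrite (cox_count cox)//.
under [RHS]eq_integral do rewrite EFinM.
rewrite ge0_integralZl//; last by move=> w _; rewrite lee_fin.
exact/measurable_EFinP.
Qed.

Lemma cox_void (A : set (plane R)) : measurable A -> bounded_in_disk A ->
  P [set w | counting_of (I w) (x w) A = 0%E] =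
  (\int[P]_w expeR (- Lambda w A))%E.
Proof.
move=> mA bA; rewrite (cox_count cox 0 mA bA).
apply: eq_integral => w _; rewrite /poisson_mass expr0 mulr1 fact0 divr1.
by rewrite -{2}(fineK (Lambda_fin Lambda_lf w mA bA)).
Qed.

Lemma void_probability :
  (limn_esup (fun n : nat => (area (disk n%:R : set (plane R)))^-1 *
       lne (\int[P]_w expeR (- Lambda w (disk n%:R)))) < 0)%E ->
  exists2 c, 0 < c & exists N, forall n, (N <= n)%N ->
    (P [set w | counting_of (I w) (x w) (disk n%:R) = 0%E] <=
     (expR (- (c * n%:R ^+ 2)))%:E)%E.
Proof.
move=> /void_rate[|c c0 [N cN]].
  by move=> n; apply: integral_ge0 => w _; exact: expeR_ge0.
exists c => //; exists N => n Nn; rewrite cox_void; first exact: cN.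
  exact: measurable_disk.
exact: disk_bounded.
Qed.

Lemma intensity_annulus w n : (Lambda w (disk (n + 4)%N%:R) -
  Lambda w (disk n%:R))%E = (fine (Lambda w (@annulus R n)))%:E.
Proof.
have mD k : measurable (disk k%:R : set (plane R)) by exact: measurable_disk.
rewrite fineK; last first.
  by apply: (Lambda_fin Lambda_lf); [exact: measurable_annulus|exact: annulus_bounded].
rewrite /annulus measureD//; last exact: Lambda_lf.
rewrite (_ : _ `&` _ = disk n%:R)//; apply/seteqP; split => [y []//|y yn].
by split => //; apply: disk_subset yn; rewrite ler_nat leq_addr.
Qed.

Hypothesis annulus_moments : forall beta : R, 0 < beta ->
    (limn_esup (fun n : nat =>
       (area (disk (n + 4)%N%:R `\` disk n%:R : set (plane R)))^-1 *
       lne (\int[P]_w expeR (beta%:E *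
              (Lambda w (disk (n + 4)%N%:R) - Lambda w (disk n%:R)))))
     < +oo)%E.

Lemma annulus_exp_rate b : 0 < b -> exists2 M : R, 0 <= M &
  exists N, forall n, (N <= n)%N ->
    (\int[P]_w (expR (b * npoints I x (@annulus R n) w))%:E <=
     (expR (M * (4 * (n + 4)%:R * Num.sqrt (8 * n%:R + 16))))%:E)%E.
Proof.
move=> b0; have c0 : 0 < expR b - 1 by rewrite subr_gt0 expR_gt1.
have [|M M0 [N MN]] := annulus_rate _ (annulus_moments c0).
  by move=> n; apply: integral_ge0 => w _; exact: expeR_ge0.
exists M => //; exists N => n Nn; apply: le_trans (MN n Nn).
rewrite cox_exp_moment; last 2 first.
- exact: measurable_annulus.
- exact: annulus_bounded.
by under [leRHS]eq_integral => w _ do rewrite intensity_annulus.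
Qed.

Hypothesis st : stationary P I x.

Lemma rectangle_bounded (a b c e : R) : bounded_in_disk (rectangle a b c e).
Proof.
exists (`|a| + `|b| + (`|c| + `|e|)) => -[s t] [/=].
rewrite !in_itv/= => /andP[sa sb] /andP[tc te]; rewrite /disk /=.
rewrite (le_trans (euclid_dist_le_l1 _ _))//= !subr0 lerD// ler_norml.
  have := ler_norm b; have := ler_norm (- a); rewrite normrN.
  by have := normr_ge0 a; have := normr_ge0 b; lra.
have := ler_norm e; have := ler_norm (- c); rewrite normrN.
by have := normr_ge0 c; have := normr_ge0 e; lra.
Qed.

(** The hypothesis says nothing about annuli of small radius. By stationarity
    the square may be moved to a distant annulus, of which the width 4 leaves
    enough room for it. *)
Lemma exp_moments_unit_square (a b : R) :
  exp_moments P I x (rectangle a (a + 1) b (b + 1)).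
Proof.
move=> beta beta0; have [M _ [N MN]] := annulus_exp_rate beta0.
set A := rectangle _ _ _ _; pose n : R := N%:R.
pose t : plane R := (a - (n + 1), b).
have E : [set y : plane R | A (y.1 + t.1, y.2 + t.2)] =
    rectangle (n + 1) (n + 2) 0 1.
  apply/seteqP; split => -[u v]; rewrite /A /rectangle /t /= !in_itv/=;
    by move=> [/= /andP[? ?] /andP[? ?]]; split; apply/andP; split; lra.
have [mR bR] := (measurable_rectangle (n + 1) (n + 2) 0 1,
  rectangle_bounded (n + 1) (n + 2) 0 1).
rewrite -(@exp_moments_shift _ _ _ P I x pp t A beta st) ?E//; last 2 first.
- exact: measurable_rectangle.
- exact: rectangle_bounded.
apply: le_lt_trans (le_lt_trans (MN N (leqnn N)) (ltry _)).
apply: ge0_le_integralT => w; rewrite lee_fin ?expR_ge0//.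
rewrite ler_expR ler_pM2l// (le_npoints pp)//; first exact: annulus_bounded.
exact: rectangle_sub_annulus.
Qed.

Lemma exp_moments_strip (a b : R) m :
  exp_moments P I x (rectangle a (a + m.+1%:R) b (b + 1)).
Proof.
elim: m => [|m IH]; first exact: exp_moments_unit_square.
apply: (@exp_moments_subset _ _ _ _ _ _ pp _
    (rectangle a (a + m.+1%:R) b (b + 1) `|`
     rectangle (a + m.+1%:R) (a + m.+1%:R + 1) b (b + 1))).
- move=> [u v]; rewrite /rectangle /= !in_itv /= -[m.+2%:R]natr1 addrA.
  move=> [/andP[au ua] vb]; have [um|mu] := leP u (a + m.+1%:R).
    by left; split => //; apply/andP.
  by right; split => //; rewrite (ltW mu).
- case: (rectangle_bounded a (a + m.+1%:R + 1) b (b + 1)) => r rP.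
  exists r; apply: subset_trans rP => -[u v]; rewrite /rectangle /= !in_itv /=.
  have := ler0n R m.+1; move: (m.+1%:R : R) => k k0.
  by case=> -[/andP[? ?] ->]; split => //; apply/andP; split; lra.
- apply: (exp_momentsU pp);
    [exact: measurable_rectangle|exact: measurable_rectangle|
     exact: rectangle_bounded|exact: rectangle_bounded|exact: IH|
     exact: exp_moments_unit_square].
Qed.

Lemma exp_moments_rectangle (a b : R) m n :
  exp_moments P I x (rectangle a (a + m.+1%:R) b (b + n.+1%:R)).
Proof.
elim: n => [|n IH]; first exact: exp_moments_strip.
apply: (@exp_moments_subset _ _ _ _ _ _ pp _
    (rectangle a (a + m.+1%:R) b (b + n.+1%:R) `|`
     rectangle a (a + m.+1%:R) (b + n.+1%:R) (b + n.+1%:R + 1))).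
- move=> [u v]; rewrite /rectangle /= !in_itv /= -[n.+2%:R]natr1 addrA.
  move=> [ua /andP[vb bv]]; have [um|mu] := leP v (b + n.+1%:R).
    by left; split => //; apply/andP.
  by right; split => //; rewrite (ltW mu).
- case: (rectangle_bounded a (a + m.+1%:R) b (b + n.+1%:R + 1)) => r rP.
  exists r; apply: subset_trans rP => -[u v]; rewrite /rectangle /= !in_itv /=.
  have := ler0n R n.+1; move: (n.+1%:R : R) => k k0.
  by case=> -[-> /andP[? ?]]; split => //; apply/andP; split; lra.
- apply: (exp_momentsU pp);
    [exact: measurable_rectangle|exact: measurable_rectangle|
     exact: rectangle_bounded|exact: rectangle_bounded|exact: IH|
     exact: exp_moments_strip].
Qed.

Lemma exp_moments_disk n : exp_moments P I x (disk n%:R).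
Proof.
apply: (@exp_moments_subset _ _ _ _ _ _ pp _
  (rectangle (- n%:R) (- n%:R + (n + n).+1%:R) (- n%:R) (- n%:R + (n + n).+1%:R))).
- move=> y yn; have := le_euclid_dist1 y (0, 0); have := le_euclid_dist2 y (0, 0).
  rewrite !subr0 => /le_trans/(_ yn) + /le_trans/(_ yn).
  rewrite !ler_norml => /andP[? ?] /andP[? ?].
  by rewrite /rectangle; split; rewrite /= in_itv/= -natr1 natrD; apply/andP; split; lra.
- exact: rectangle_bounded.
- exact: exp_moments_rectangle.
Qed.

End cox_voronoi.

(** * Exponential moments of the length *)

Lemma geometric_nneseries_fin (R : realType) (a q : R) : 0 <= a -> 0 <= q < 1 ->
  (\sum_(n <oo) (a * q ^+ n)%:E < +oo)%E.
Proof.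
move=> a0 /andP[q0 q1]; have nq1 : `|q| < 1 by rewrite ger0_norm.
have := @is_cvg_geometric_series R a q nq1 => cv.
rewrite (_ : (\sum_(n <oo) _)%E = (limn (series (geometric a q)))%:E) ?ltry//.
apply/cvg_lim => //; rewrite (_ : (fun n => _) = EFin \o series (geometric a q)).
  by apply: cvg_EFin; [exact: nearW|].
by apply/funext => n /=; rewrite sumEFin.
Qed.

(** A form of [a * e <= s * a ^ 2 + e ^ 2 / s]. Used with an indicator for [a],
    it decouples the event that a disk is empty from the number of points in
    the annulus around it. *)
Lemma expR_le_split (R : realType) (u y : R) :
  expR y <= expR u + expR (- u) * expR (y * 2).
Proof.
rewrite -expRD; have [yu|uy] := leP y u.
  by apply: ler_wpDr; [exact: expR_ge0|rewrite ler_expR].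
by apply: ler_wpDl; [exact: expR_ge0|rewrite ler_expR; lra].
Qed.

Section voronoi_moments.
Context d (Omega : measurableType d) (R : realType) (P : probability Omega R).
Variables (I : Omega -> set nat) (x : Omega -> nat -> plane R).
Hypothesis pp : is_point_process I x.

Let N A w := counting_of (I w) (x w) A.
Let H w := hausdorff1 (voronoi (I w) (x w) `&` disk 1).

Lemma voronoi_length_npoints w (r : R) (A : set (plane R)) :
  bounded_in_disk A -> (N (disk r) w != 0)%E ->
  (forall i, I w i -> disk (r + 2) (x w i) -> A (x w i)) ->
  (H w <= (32 * npoints I x A w)%:E)%E.
Proof.
move=> bA Nr rA; rewrite EFinM -(counting_of_fin pp w bA).
apply: voronoi_length_near Nr rA _; first exact: pp.2.
by rewrite (counting_of_fin pp w bA) ltry.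
Qed.

(** If [m] is the largest integer radius of an empty [disk m], the cells that meet
    the unit disk belong to points outside [disk m] and inside
    [disk (m.+1 + 2)]; the cut-off [m0] keeps [m] in the range where the
    asymptotic hypotheses say something. *)
Lemma voronoi_length_cases w (m0 : nat) :
  (H w <= 0)%E \/
  (H w <= (32 * npoints I x (disk (m0 + 2)%N%:R) w)%:E)%E \/
  exists2 m, (m0 <= m)%N & N (disk m%:R) w = 0%E /\
    (H w <= (32 * npoints I x (@annulus R m) w)%:E)%E.
Proof.
have [Nm0|Nm0] := eqVneq (N (disk m0%:R) w) 0%E; last first.
  right; left; apply: voronoi_length_npoints Nm0 _; first exact: disk_bounded.
  by move=> i _; rewrite natrD.
have [ex|nex] := pselect (exists k, N (disk k%:R) w != 0%E); last first.
  left; suff : (H w <= 32%:E * counting_of (I w) (x w) set0)%E.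
    by rewrite counting_ofE setI0 esum_set0 mule0.
  apply: voronoi_length; first exact: pp.2.
  - by rewrite counting_ofE setI0 esum_set0 ltry.
  - move=> i y Ii _ _; apply: nex.
    exists (Num.truncn (euclid_dist (x w i) (0, 0))).+1; apply/eqP => N0.
    by apply: (counting_of_eq0 N0 Ii); rewrite /disk /= ltW// truncnS_gt.
right; right; case: (ex_minnP ex) => k Nk kmin.
case: k Nk kmin => [|m] Nk kmin.
  suff : N (disk 0%:R) w = 0%E by move=> N0; rewrite N0 eqxx in Nk.
  apply: le_anti; rewrite esum_ge0// andbT -Nm0; apply: counting_of_subset.
  by apply: disk_subset; rewrite ler_nat.
have Nm : N (disk m%:R) w = 0%E.
  by apply/eqP; apply: contraT => /kmin; rewrite ltnn.
exists m.
  rewrite leqNgt; apply/negP => mm0; move/negP: Nk; apply; apply/eqP.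
  apply: le_anti; rewrite esum_ge0// andbT -Nm0; apply: counting_of_subset.
  by apply: disk_subset; rewrite ler_nat.
split => //; apply: voronoi_length_npoints Nk _; first exact: annulus_bounded.
move=> i Ii xi; split; last exact: counting_of_eq0 Nm Ii.
apply: (@disk_subset _ (m.+1%:R + 2) (m + 4)%N%:R _ (x w i) xi).
by rewrite -natrD ler_nat addSnnS leq_add2l.
Qed.

Hypothesis disk_moments : forall n, exp_moments P I x (disk n%:R).
Hypothesis void : exists2 c : R, 0 < c & exists n0, forall n, (n0 <= n)%N ->
  (P [set w | N (disk n%:R) w = 0%E] <= (expR (- (c * n%:R ^+ 2)))%:E)%E.
Hypothesis annulus_moment : forall b, 0 < b -> forall e, 0 < e ->
  exists n0, forall n, (n0 <= n)%N ->
  (\int[P]_w (expR (b * npoints I x (@annulus R n) w))%:E <=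
   (expR (e * n%:R ^+ 2))%:E)%E.

Lemma measurable_void (A : set (plane R)) : measurable A ->
  measurable [set w | N A w = 0%E].
Proof.
move=> mA; rewrite (_ : [set w | _] = setT `&` N A @^-1` [set 0%E]).
  exact: pp.1.
by rewrite setTI.
Qed.

(** On the event that [m] is the radius found in [voronoi_length_cases], the
    exponential moment is at most [expR u * void + expR (- u) * moment], where
    [void <= expR (- c * m ^ 2)] and [moment <= expR (c / 4 * m ^ 2)]. The choice
    [u = c / 2 * m ^ 2] makes both products at most [expR (- c / 4 * m ^ 2)],
    which is summable in [m]. *)
Lemma voronoi_exp_moment (g : R) : 0 < g ->
  (\int[P]_w expeR (g%:E * H w) < +oo)%E.
Proof.
move=> g0; pose b := g * 32; have b0 : 0 < b by rewrite mulr_gt0.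
have [c c0 [n1 void1]] := void.
have [n2 ann2] := annulus_moment (mulr_gt0 b0 (ltr0n R 2)) (divr_gt0 c0 (ltr0n R 4)).
pose m0 := maxn n1 n2.
pose u m : R := c / 2 * (m0 + m)%:R ^+ 2.
pose V m : set Omega := [set w | N (disk (m0 + m)%:R) w = 0%E].
have mV m : measurable (V m) by apply: measurable_void; exact: measurable_disk.
pose T m w : \bar R := ((expR (u m))%:E * (\1_(V m) w)%:E +
  (expR (- u m))%:E *
    (expR (b * 2 * npoints I x (@annulus R (m0 + m)) w))%:E)%E.
pose D w : \bar R := (expR (b * npoints I x (disk (m0 + 2)%N%:R) w))%:E.
have mD : measurable_fun setT D.
  by apply: (measurable_exp_npoints pp); exact: measurable_disk.
have mE m : measurable_fun setT (fun w =>
    (expR (b * 2 * npoints I x (@annulus R (m0 + m)) w))%:E : \bar R).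
  by apply: (measurable_exp_npoints pp); exact: measurable_annulus.
have mI m : measurable_fun setT (fun w => (\1_(V m) w)%:E : \bar R).
  by apply/measurable_EFinP; exact: measurable_indic.
have mT m : measurable_fun setT (T m).
  by apply: emeasurable_funD; apply: measurable_funeM.
have T1ge0 m w : (0 <= (expR (u m))%:E * (\1_(V m) w)%:E)%E.
  by rewrite mule_ge0 ?lee_fin ?expR_ge0.
have T2ge0 m w : (0 <= (expR (- u m))%:E *
    (expR (b * 2 * npoints I x (@annulus R (m0 + m)) w))%:E)%E.
  by rewrite mule_ge0 ?lee_fin ?expR_ge0.
have Tge0 m w : (0 <= T m w)%E by rewrite adde_ge0.
have Dge0 w : (0 <= D w)%E by rewrite lee_fin expR_ge0.
have Sge0 w : (0 <= \sum_(m <oo) T m w)%E by apply: nneseries_ge0.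
have expb y : expeR (g%:E * (32 * y)%:E) = (expR (b * y))%:E.
  by rewrite -EFinM /= mulrA.
have bound w : (expeR (g%:E * H w) <= 1 + D w + \sum_(m <oo) T m w)%E.
  have mono z : (H w <= z)%E -> (expeR (g%:E * H w) <= expeR (g%:E * z))%E.
    by move=> Hz; rewrite lee_expeR lee_pmul2l.
  case: (voronoi_length_cases w m0) => [/mono/le_trans|[/mono/le_trans|]].
  - by rewrite mule0 expeR0; apply; rewrite -addeA leeDl// adde_ge0.
  - rewrite expb; apply; rewrite -/(D w) -addeA addeCA leeDl//.
    by rewrite adde_ge0.
  - move=> [m m0m [Nm /mono/le_trans]]; rewrite expb; apply.
    apply: le_trans (leeDr _ _); last by rewrite adde_ge0.
    have mE' : (m0 + (m - m0))%N = m by rewrite subnKC.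
    apply: (@le_trans _ _ (T (m - m0)%N w)).
      rewrite /T indicE mem_set; last by rewrite /V /= mE'.
      rewrite mE' mule1 -EFinM -EFinD lee_fin.
      by have := expR_le_split (u (m - m0)%N) (b * npoints I x (annulus m) w);
        rewrite -(mulrAC b).
    apply: le_trans (nneseries_lim_ge (m - m0).+1 _) => //.
    by rewrite big_nat_recr//= leeDr// sume_ge0.
apply: le_lt_trans (ge0_le_integralT P (fun w => expeR_ge0 _) bound) _.
rewrite ge0_integralD//; last 3 first.
- by move=> w _; rewrite adde_ge0.
- exact: emeasurable_funD.
- exact: ge0_emeasurable_sum.
have P1 : (\int[P]_(w in setT) 1 = 1 :> \bar R)%E.
  by rewrite (integral_cst P measurableT 1) mul1e; exact: probability_setT.
rewrite ge0_integralD// P1.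
apply: lte_add_pinfty; first by apply: lte_add_pinfty; [exact: ltry|exact: disk_moments].
rewrite integral_nneseries//.
pose q := expR (- (c / 4)).
apply: le_lt_trans (@geometric_nneseries_fin R 2 q _ _) => //; last first.
  by rewrite expR_ge0 expR_lt1 oppr_lt0 divr_gt0.
apply: lee_nneseries => [m _ _|m _]; first by apply: integral_ge0.
rewrite ge0_integralD//; [|exact: measurable_funeM..].
rewrite !ge0_integralZl//; [|by rewrite lee_fin expR_ge0..].
rewrite integral_indic// setIT.
have le1 : (n1 <= m0 + m)%N by rewrite (leq_trans (leq_maxl _ n2))// leq_addr.
have le2 : (n2 <= m0 + m)%N by rewrite (leq_trans (leq_maxr n1 _))// leq_addr.
have eu0 y : (0 <= (expR y)%:E :> \bar R)%E by rewrite lee_fin expR_ge0.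
apply: le_trans (leeD (lee_wpmul2l (eu0 _) (void1 _ le1))
  (lee_wpmul2l (eu0 _) (ann2 _ le2))) _.
rewrite -!EFinM -EFinD lee_fin -!expRD /q -expRM_natl.
have m2 : m%:R <= (m0 + m)%:R ^+ 2 :> R.
  rewrite -natrX ler_nat (leq_trans (leq_addl m0 m))//.
  by rewrite -mulnn; case: (m0 + m)%N => // k; exact: leq_pmulr.
have cm := ler_wpM2l (ltW c0) m2.
have cm0 : 0 <= c * m%:R by rewrite mulr_ge0// ltW.
rewrite mulr2n mulrDl !mul1r lerD// ler_expR /u; move: (_ ^+ 2) cm => y cm; lra.
Qed.

End voronoi_moments.

Theorem proposition1p6 (R : realType) (d : measure_display)
  (Omega : measurableType d) (P : probability Omega R)
  (Lambda : R.-ker Omega ~> plane R)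
  (I : Omega -> set nat) (X : Omega -> nat -> plane R) (lambda : R)
  (Lambda_lf : forall w, locally_finite (Lambda w))
  (X_pp : is_point_process I X)
  (X_stationary : stationary P I X)
  (lambda_gt0 : 0 < lambda)
  (X_intensity : has_intensity P I X lambda)
  (X_cox : is_cox P Lambda I X)
  (void_decay :
    (limn_esup (fun n : nat =>
       (area (disk n%:R))^-1 *
       lne (\int[P]_w expeR (- Lambda w (disk n%:R)))) < 0)%E)
  (annulus_moments : forall beta : R, 0 < beta ->
    (limn_esup (fun n : nat =>
       (area (disk (n + 4)%N%:R `\` disk n%:R))^-1 *
       lne (\int[P]_w expeR (beta%:E *
              (Lambda w (disk (n + 4)%N%:R) - Lambda w (disk n%:R)))))
     < +oo)%E) :
  forall alpha : R,
    (\int[P]_w expeR (alpha%:E * hausdorff1 (voronoi (I w) (X w) `&` disk 1))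
     < +oo)%E.
Proof.
have disk_moments := exp_moments_disk Lambda_lf X_pp X_cox annulus_moments X_stationary.
have void := void_probability Lambda_lf X_cox void_decay.
have annulus_moment b : 0 < b -> forall e, 0 < e ->
    exists n0, forall n, (n0 <= n)%N ->
    (\int[P]_w (expR (b * npoints I X (@annulus R n) w))%:E <=
     (expR (e * n%:R ^+ 2))%:E)%E.
  move=> b0 e e0.
  have [M M0 [n1 h1]] := annulus_exp_rate Lambda_lf X_pp X_cox annulus_moments b0.
  have M1 : 0 < M + 1 by rewrite ltr_wpDl.
  have [n2 h2] := annulus_area_negligible (divr_gt0 e0 M1).
  exists (maxn n1 n2) => n; rewrite geq_max => /andP[/h1/le_trans h /h2 {}h2].
  apply: h; rewrite lee_fin ler_expR.
  set a := 4 * _ * _ in h2 *; have a0 : 0 <= a by rewrite !mulr_ge0 ?sqrtr_ge0.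
  apply: (@le_trans _ _ ((M + 1) * a)); first by rewrite ler_wpM2r// lerDl.
  by rewrite -ler_pdivlMl// mulrA (mulrC _ e).
have main := voronoi_exp_moment X_pp disk_moments void annulus_moment.
move=> alpha; have [a0|a0] := ltP 0 alpha; first exact: main.
apply: le_lt_trans (main 1 ltr01).
apply: ge0_le_integralT => w; first exact: expeR_ge0.
by rewrite lee_expeR lee_wpmul2r ?hausdorff1_ge0// lee_fin (le_trans a0).
Qed.
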